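(* Let $k$ be a commutative ring with unit. For every $\mathcal{F}$-module $F$ over $k$, cyclic Gamma homology in degree zero is isomorphic to cyclic homology in degree one: $H\Gamma C_0(F)\cong HC_1(F)$. In particular, for every commutative unital $k$-algebra $A$, $H\Gamma C_0(A)\cong HC_1(A)$.
   Context: $\mathcal{F}$ is the skeleton of the category of finite (unpointed) sets with objects $\underline{n}=\{0,\dots,n\}$, $n\ge0$, and all maps; an $\mathcal{F}$-module is a covariant functor from $\mathcal{F}$ to $k$-modules. $\Gamma$ is the skeleton of the category of finite pointed sets with objects $[n]=\{0,\dots,n\}$, $n\ge0$, based at $0$, and pointed maps. The functor $\nu\colon\mathcal{F}\to\Gamma$, $\nu(\underline{m})=[m+1]$, adds an extra basepoint, and $\nu^*$ denotes precomposition with it. For a contravariant functor $T$ and a covariant functor $F$ on $\mathcal{F}$ with values in $k$-modules, $T\otimes_{\mathcal{F}}F$ is the tensor product of functors (coend), and $\mathrm{Tor}_*^{\mathcal{F}}$ denotes its left derived functors. Cyclic Gamma homology. $t$ is the contravariant functor on $\Gamma$ given by $t[n]=\mathrm{Hom}_{\mathsf{Sets}_*}([n],k)$ (pointed maps, $k$ based at $0$). $\mathcal{F}_0(\underline{m})=k[\mathcal{F}(\underline{m},\underline{0})]$. The contravariant functor $\overline{t}$ on $\mathcal{F}$ is defined by the exact sequence $0\to\mathcal{F}_0\to\nu^*t\to\overline{t}\to0$, where $\mathcal{F}_0\to\nu^*t$ sends $\lambda f$ ($\lambda\in k$, $f\colon\underline{n}\to\underline{0}$) to the function in $\mathrm{Hom}_{\mathsf{Sets}_*}([n+1],k)$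 with value $\lambda$ on $1,\dots,n+1$. Define $H\Gamma C_n(F)=\mathrm{Tor}_n^{\mathcal{F}}(\overline{t},F)$. Cyclic homology of an $\mathcal{F}$-module $F$. Let $b=\sum_{i=0}^n(-1)^iF(d_i)\colon F(\underline{n})\to F(\underline{n-1})$, where $d_i$ for $i<n$ is the order-preserving surjection sending $i$ and $i+1$ to $i$, and $d_n$ sends $0$ and $n$ to $0$ and is the identity on all other elements. Let $\tau$ be the cyclic permutation $i\mapsto i+1$ modulo $n+1$ of $\underline{n}$, $t_n=(-1)^nF(\tau)$ on $F(\underline{n})$, $s\colon\underline{n}\to\underline{n+1}$, $s(i)=i+1$, $N=\sum_{i=1}^{n+1}t_n^i$, and $B=(1-t_{n+1})\circ F(s)\circ N\colon F(\underline{n})\to F(\underline{n+1})$. Then $HC_*(F)$ is the homology of the total complex with $\bigoplus_{j\ge0}F(\underline{n-2j})$ in degree $n$ and differential $b+B$. For a commutative unital $k$-algebra $A$, $\mathcal{L}(A)$ is the $\mathcal{F}$-module $\underline{n}\mapsto A^{\otimes n+1}$ (tensor over $k$), where $f\colon\underline{n}\to\underline{m}$ induces $a_0\otimes\cdots\otimes a_n\mapsto b_0\otimes\cdots\otimes b_m$ with $b_i=\prod_{j\in f^{-1}(i)}a_j$ (and $b_i=1$ if $f^{-1}(i)=\varnothing$). Put $H\Gamma C_*(A)=H\Gamma C_*(\mathcal{L}(A))$ and $HC_*(A)=HC_*(\mathcal{L}(A))$. *)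

(* Defs.v *)
From HB Require Import structures.
From mathcomp Require Import all_boot all_algebra.
From mathcomp Require Import boolp classical_sets functions cardinality fsbigop.

Set Implicit Arguments.
Unset Strict Implicit.
Unset Printing Implicit Defensive.

Import GRing.Theory.
Local Open Scope ring_scope.

Section Span.
Variables (k : comPzRingType) (V : lmodType k) (S : V -> Prop).

Inductive span : V -> Prop :=
| span0 : span 0
| span_step a x v : S x -> span v -> span (a *: x + v).

Lemma span_gen x : S x -> span x.
Proof. by move=> Sx; rewrite -[x]addr0 -[x]scale1r; apply: span_step Sx span0. Qed.

Lemma spanD x y : span x -> span y -> span (x + y).
Proof.
by move=> + sy; elim=> [|a u v Su _ IH]; rewrite ?add0r// -addrA; apply: span_step.
Qed.

Lemma spanZ a x : span x -> span (a *: x).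
Proof.
elim=> [|b u v Su _ IH]; first by rewrite scaler0; exact: span0.
by rewrite scalerDr scalerA; apply: span_step.
Qed.

Definition spanb : {pred V} := fun v => `[< span v >].

Lemma spanbP v : reflect (span v) (v \in spanb).
Proof. exact: asboolP. Qed.

Lemma spanb_submod : GRing.submod_closed spanb.
Proof.
split=> [|a u v /spanbP su /spanbP sv]; apply/spanbP; first exact: span0.
by apply: spanD => //; apply: spanZ.
Qed.

HB.instance Definition _ := GRing.isSubmodClosed.Build k V spanb spanb_submod.

End Span.

Section Quotient.
Variables (k : comPzRingType) (V : lmodType k) (S : V -> Prop).

(* V / <S>, with S an arbitrary set of relations *)
Definition quotm := Quotient.quot (spanb S).
HB.instance Definition _ := GRing.Zmodule.on quotm.

Definition qpi (v : V) : quotm := (\pi_quotm v)%qT.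

Lemma qpi_eq u v : qpi u = qpi v <-> span S (u - v).
Proof.
rewrite /qpi; split=> [/eqP|/spanbP uv]; last apply/eqP;
  rewrite -(Quotient.idealrBE (spanb S)) //.
by move/spanbP.
Qed.

Lemma qpi_repr (x : quotm) : qpi (repr x) = x.
Proof. exact: reprK. Qed.

Lemma qpi_surj (x : quotm) : exists v, qpi v = x.
Proof. by exists (repr x); exact: qpi_repr. Qed.

Lemma qpi_is_zmod : zmod_morphism qpi.
Proof. by move=> u v; rewrite /qpi raddfB. Qed.

Definition quotm_scale (a : k) (x : quotm) : quotm := qpi (a *: repr x).

Lemma quotm_scaleE a v : quotm_scale a (qpi v) = qpi (a *: v).
Proof.
apply/qpi_eq; rewrite -scalerBr; apply: spanZ.
by apply/qpi_eq; rewrite qpi_repr.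
Qed.

Lemma qpiD u v : qpi (u + v) = qpi u + qpi v.
Proof.
have qpi0 : qpi 0 = 0 by rewrite -[X in qpi X](subrr 0) qpi_is_zmod subrr.
by rewrite -[v in LHS]opprK qpi_is_zmod -[- v]sub0r qpi_is_zmod qpi0 sub0r opprK.
Qed.

Lemma quotm_scaleA a b v : quotm_scale a (quotm_scale b v) = quotm_scale (a * b) v.
Proof. by rewrite -(qpi_repr v) !quotm_scaleE scalerA. Qed.
Lemma quotm_scale1 : left_id 1 quotm_scale.
Proof. by move=> v; rewrite -(qpi_repr v) !quotm_scaleE scale1r. Qed.
Lemma quotm_scaleDr : right_distributive quotm_scale +%R.
Proof.
move=> a u v; rewrite -(qpi_repr u) -(qpi_repr v).
by rewrite -qpiD !quotm_scaleE scalerDr qpiD.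
Qed.
Lemma quotm_scaleDl v : {morph quotm_scale^~ v : a b / a + b}.
Proof. by move=> a b; rewrite -(qpi_repr v) !quotm_scaleE scalerDl qpiD. Qed.

HB.instance Definition _ := GRing.Zmodule_isLmodule.Build k quotm
  quotm_scaleA quotm_scale1 quotm_scaleDr quotm_scaleDl.

Lemma qpi_is_linear : linear qpi.
Proof. by move=> a u v; rewrite qpiD -quotm_scaleE. Qed.
HB.instance Definition _ := GRing.isLinear.Build k V quotm _ qpi qpi_is_linear.

Section Lift.
Variables (W : lmodType k) (f : {linear V -> W}).
Hypothesis fS : forall v, S v -> f v = 0.

Definition qlift_fun of (forall v, S v -> f v = 0) := fun x : quotm => f (repr x).

Lemma qlift_funE v : qlift_fun fS (qpi v) = f v.
Proof.
have fspan u : span S u -> f u = 0.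
  elim=> [|a x w Sx _ IH]; first exact: linear0.
  by rewrite linearP IH (fS Sx) scaler0 addr0.
by apply/eqP; rewrite -subr_eq0 -linearB fspan//; apply/qpi_eq; rewrite qpi_repr.
Qed.

Lemma qlift_linear : linear (qlift_fun fS).
Proof.
move=> a u v; rewrite -(qpi_repr u) -(qpi_repr v) -linearP !qlift_funE.
exact: linearP.
Qed.
HB.instance Definition _ :=
  GRing.isLinear.Build k quotm W _ (qlift_fun fS) qlift_linear.
Definition qlift : {linear quotm -> W} := qlift_fun fS.

Lemma qliftE v : qlift (qpi v) = f v.
Proof. exact: qlift_funE. Qed.
End Lift.

End Quotient.

Section Kernel.
Variables (k : comPzRingType) (V W : lmodType k) (f : {linear V -> W}).

Definition in_ker : {pred V} := fun v => f v == 0.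
Lemma in_ker_submod : GRing.submod_closed in_ker.
Proof.
split=> [|a u v]; rewrite !unfold_in ?linear0// => /eqP fu /eqP fv.
by rewrite linearP fu fv scaler0 addr0.
Qed.
HB.instance Definition _ := GRing.isSubmodClosed.Build k V in_ker in_ker_submod.

Definition kermod := {v : V | v \in in_ker}.
HB.instance Definition _ := SubChoice.on kermod.
HB.instance Definition _ := [SubChoice_isSubLmodule of kermod by <:].

Definition kerval : {linear kermod -> V} := val.
Lemma kervalP (x : kermod) : f (kerval x) = 0.
Proof. by apply/eqP; exact: (valP x). Qed.

Section Corestrict.
Variables (U : lmodType k) (g : {linear U -> V}).
Hypothesis fg : forall u, f (g u) = 0.
Lemma kercor_subproof u : g u \in in_ker.
Proof. by rewrite unfold_in fg. Qed.
Definition kercor_fun of (forall u, f (g u) = 0) :=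
  fun u : U => exist (fun v => v \in in_ker) (g u) (kercor_subproof u) : kermod.
Lemma kercor_linear : linear (kercor_fun fg).
Proof. by move=> a u v; apply: val_inj; rewrite /= linearP. Qed.
HB.instance Definition _ :=
  GRing.isLinear.Build k U kermod _ (kercor_fun fg) kercor_linear.
Definition kercor : {linear U -> kermod} := kercor_fun fg.
End Corestrict.
End Kernel.

Section FreeModule.
Variables (k : comPzRingType) (X : choiceType).

Definition finsupported : {pred X -> k^o} :=
  fun u => `[< finite_set [set x | u x <> 0] >].

Lemma finsupported_submod : GRing.submod_closed finsupported.
Proof.
split=> [|a u v /asboolP fu /asboolP fv]; apply/asboolP.
  by rewrite (_ : mkset _ = set0)//; apply/seteqP; split.
have fuv : finite_set ([set x | u x <> 0] `|` [set x | v x <> 0])%classic.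
  by rewrite finite_setU.
apply: sub_finite_set fuv => x /= uvx.
apply: contrapT => /not_orP[/contrapT ux /contrapT vx]; apply: uvx.
by rewrite -[LHS]/(a *: u x + v x) ux vx scaler0 addr0.
Qed.
HB.instance Definition _ :=
  GRing.isSubmodClosed.Build k (X -> k^o) finsupported finsupported_submod.

Definition freemod := {u : X -> k^o | u \in finsupported}.
HB.instance Definition _ := SubChoice.on freemod.
HB.instance Definition _ := [SubChoice_isSubLmodule of freemod by <:].

Lemma freemodP (u : freemod) : finite_set [set x | val u x <> 0].
Proof. by case: u => u /= /asboolP. Qed.

Lemma fgen_subproof x : (fun y : X => (y == x)%:R : k^o) \in finsupported.
Proof.
apply/asboolP; apply: sub_finite_set (finite_set1 x) => y /=.
by case: eqP.
Qed.
Definition fgen (x : X) : freemod := exist (fun u => u \in finsupported) _ (fgen_subproof x).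

Section Lift.
Variables (V : lmodType k) (f : X -> V).

(* the extension of f to a linear map; a finite sum, since u has finite support *)
Definition flift_fun (u : freemod) : V := \sum_(x \in [set: X]) val u x *: f x.

Lemma flift_funE (u : freemod) (r : seq X) : uniq r ->
    (forall x, x \notin r -> val u x = 0) ->
  flift_fun u = \sum_(x <- r) val u x *: f x.
Proof.
move=> ur r0; rewrite /flift_fun (fsbigE r) //=.
  by rewrite big_mkcond; apply: eq_bigr => x _; rewrite in_setT.
by move=> x _ /r0 ->; rewrite scale0r.
Qed.

Lemma freemod_suppP (u : freemod) :
  exists2 r : seq X, uniq r & forall x, x \notin r -> val u x = 0.
Proof.
have /finite_seqP[r rE] := freemodP u.
exists (undup r); first exact: undup_uniq.
move=> x; rewrite mem_undup => /negP xr; apply: contrapT => ux.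
by have : [set x | val u x <> 0]%classic x by []; rewrite rE.
Qed.

Lemma flift_linear : linear flift_fun.
Proof.
move=> a u v.
have [ru _ u0] := freemod_suppP u; have [rv _ v0] := freemod_suppP v.
have r0 w : (forall x, x \notin ru -> x \notin rv -> val w x = 0) ->
    forall x, x \notin undup (ru ++ rv) -> val w x = 0.
  by move=> w0 x; rewrite mem_undup mem_cat negb_or => /andP[]; exact: w0.
rewrite !(@flift_funE _ (undup (ru ++ rv))) ?undup_uniq//; do ?[apply: r0].
- rewrite scaler_sumr -big_split; apply: eq_bigr => x _.
  by rewrite -[val (a *: u + v) x]/(a * val u x + val v x) scalerDl scalerA.
- by move=> x _ /v0.
- by move=> x /u0.
- by move=> x /u0 ux /v0 vx; rewrite -[LHS]/(a * val u x + val v x) ux vx mulr0 addr0.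
Qed.
HB.instance Definition _ :=
  GRing.isLinear.Build k freemod V _ flift_fun flift_linear.
Definition flift : {linear freemod -> V} := flift_fun.

Lemma flift_gen x : flift (fgen x) = f x.
Proof.
rewrite -[LHS]/(flift_fun _) (@flift_funE _ [:: x])//.
  by rewrite big_seq1 /= eqxx scale1r.
by move=> y; rewrite inE /= => /negPf ->.
Qed.
End Lift.

Lemma freemodE (u : freemod) : u = flift fgen u.
Proof.
have [r ur r0] := freemod_suppP u.
rewrite -[RHS]/(flift_fun _ _) (flift_funE _ ur r0).
apply: val_inj; apply/funext => x.
have -> : val (\sum_(y <- r) val u y *: fgen y) x =
          \sum_(y <- r) val u y * (x == y)%:R.
  elim: r {ur r0} => [|y r IH]; first by rewrite !big_nil.
  by rewrite !big_cons -IH.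
have [xr|xr] := boolP (x \in r).
  rewrite (bigD1_seq x)//= eqxx mulr1 big1 ?addr0// => y /negPf.
  by rewrite eq_sym => ->; rewrite mulr0.
rewrite r0// big1_seq// => y /andP[_ yr].
by case: eqP xr => [->|]; rewrite ?yr ?mulr0.
Qed.

Lemma flift_ext (V : lmodType k) (f g : {linear freemod -> V}) :
  (forall x, f (fgen x) = g (fgen x)) -> f =1 g.
Proof.
move=> fg u; have [r ur r0] := freemod_suppP u.
rewrite (freemodE u) -[flift _ _]/(flift_fun _ _) (flift_funE _ ur r0).
by rewrite !linear_sum; apply: eq_bigr => x _; rewrite !linearZ fg.
Qed.
End FreeModule.

Definition lmod_iso (k : comPzRingType) (V W : lmodType k) : Prop :=
  exists f : {linear V -> W}, bijective f.

Record category := Category {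
  ob :> choiceType;
  hom : ob -> ob -> choiceType;
  idm : forall x, hom x x;
  comp : forall x y z, hom y z -> hom x y -> hom x z;
  comp1m : forall x y (f : hom x y), comp (idm y) f = f;
  compm1 : forall x y (f : hom x y), comp f (idm x) = f;
  compA : forall w x y z (h : hom y z) (g : hom x y) (f : hom w x),
    comp h (comp g f) = comp (comp h g) f
}.

Definition opcat (C : category) : category :=
  @Category C (fun x y => hom y x) (@idm C)
    (fun x y z (g : hom z y) (f : hom y x) => comp f g)
    (fun x y f => compm1 f) (fun x y f => comp1m f)
    (fun w x y z h g f => esym (compA f g h)).

Record catfunctor (C D : category) := CatFunctor {
  cobj :> C -> D;
  cmap : forall x y, hom x y -> hom (cobj x) (cobj y);
  cmap1 : forall x, cmap (idm x) = idm (cobj x);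
  cmapM : forall x y z (g : hom y z) (f : hom x y),
    cmap (comp g f) = comp (cmap g) (cmap f)
}.

(* covariant functors to k-modules; contravariant ones are [modfunctor k (opcat C)] *)
Record modfunctor (k : comPzRingType) (C : category) := ModFunctor {
  fobj :> C -> lmodType k;
  fmap : forall x y, hom x y -> {linear fobj x -> fobj y};
  fmap1 : forall x u, fmap (idm x) u = u;
  fmapM : forall x y z (g : hom y z) (f : hom x y) u,
    fmap (comp g f) u = fmap g (fmap f u)
}.

Record nattrans (k : comPzRingType) (C : category) (A B : modfunctor k C) :=
  NatTrans {
    ncomp :> forall x, {linear A x -> B x};
    ncompN : forall x y (f : hom x y) u, ncomp y (fmap A f u) = fmap B f (ncomp x u)
  }.

Section FunctorConstructions.
Variables (k : comPzRingType) (C : category).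
Implicit Types A B : modfunctor k C.

Section KernelCokernel.
Variables (A B : modfunctor k C) (phi : nattrans A B).

Lemma kerfun_subproof x y (f : hom x y) (u : kermod (phi x)) :
  phi y ((fmap A f \o kerval (phi x)) u) = 0.
Proof. by rewrite /= ncompN kervalP linear0. Qed.
Definition kerfun_map x y (f : hom x y) :
    {linear kermod (phi x) -> kermod (phi y)} :=
  kercor (kerfun_subproof f).
Lemma kerfun_map1 x u : kerfun_map (idm x) u = u.
Proof. by apply: val_inj; rewrite /= fmap1. Qed.
Lemma kerfun_mapM x y z (g : hom y z) (f : hom x y) u :
  kerfun_map (comp g f) u = kerfun_map g (kerfun_map f u).
Proof. by apply: val_inj; rewrite /= fmapM. Qed.
Definition kerfun : modfunctor k C := ModFunctor kerfun_map1 kerfun_mapM.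

Definition kerfun_incl : nattrans kerfun A :=
  @NatTrans k C kerfun A (fun x => kerval (phi x)) (fun x y f u => erefl).

Definition cokerfun_rel x : B x -> Prop := fun v => exists u, phi x u = v.
Lemma cokerfun_subproof x y (f : hom x y) v : cokerfun_rel v ->
  (qpi (@cokerfun_rel y) \o fmap B f) v = 0.
Proof.
move=> [u <-] /=; rewrite -ncompN -(linear0 (qpi (@cokerfun_rel y))).
by apply/qpi_eq; rewrite subr0; apply: span_gen; exists (fmap A f u).
Qed.
Definition cokerfun_map x y (f : hom x y) :
    {linear quotm (@cokerfun_rel x) -> quotm (@cokerfun_rel y)} :=
  qlift (@cokerfun_subproof x y f).
Lemma cokerfun_mapE x y (f : hom x y) v :
  cokerfun_map f (qpi (@cokerfun_rel x) v) = qpi (@cokerfun_rel y) (fmap B f v).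
Proof. exact: qliftE. Qed.
Lemma cokerfun_map1 x u : cokerfun_map (idm x) u = u.
Proof. by have [v <-] := qpi_surj u; rewrite cokerfun_mapE fmap1. Qed.
Lemma cokerfun_mapM x y z (g : hom y z) (f : hom x y) u :
  cokerfun_map (comp g f) u = cokerfun_map g (cokerfun_map f u).
Proof. by have [v <-] := qpi_surj u; rewrite !cokerfun_mapE fmapM. Qed.
Definition cokerfun : modfunctor k C := ModFunctor cokerfun_map1 cokerfun_mapM.
End KernelCokernel.

Section Composite.
Variables (A B D : modfunctor k C) (psi : nattrans B D) (phi : nattrans A B).
Lemma natcomp_subproof x y (f : hom x y) u :
  (psi y \o phi y) (fmap A f u) = fmap D f ((psi x \o phi x) u).
Proof. by rewrite /= !ncompN. Qed.
Definition natcomp : nattrans A D :=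
  @NatTrans k C A D (fun x => psi x \o phi x) natcomp_subproof.
End Composite.

(** k-linearisation of the Set-valued functor sending x to the disjoint union,
    over i in I, of hom (c i) x *)
Section FreeFunctor.
Variables (I : choiceType) (c : I -> C).
Definition sumhom (x : C) : choiceType := {i : I & hom (c i) x}.
Definition freefun_map x y (f : hom x y) :
    {linear freemod k (sumhom x) -> freemod k (sumhom y)} :=
  flift (fun p : sumhom x =>
    fgen k (Tagged (fun i => hom (c i) y) (comp f (tagged p)))).
Lemma freefun_mapE x y (f : hom x y) (p : sumhom x) :
  freefun_map f (fgen k p) =
  fgen k (Tagged (fun i => hom (c i) y) (comp f (tagged p))).
Proof. exact: flift_gen. Qed.
Lemma freefun_map1 x u : freefun_map (idm x) u = u.
Proof.
rewrite [RHS](freemodE u); apply: flift_ext => -[i h].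
by rewrite flift_gen freefun_mapE /= comp1m.
Qed.
Lemma freefun_mapM x y z (g : hom y z) (f : hom x y) u :
  freefun_map (comp g f) u = freefun_map g (freefun_map f u).
Proof.
rewrite -[RHS]/((freefun_map g \o freefun_map f) u); apply: flift_ext => -[i h].
by rewrite -[RHS]/(freefun_map g (freefun_map f _)) !freefun_mapE /= compA.
Qed.
Definition freefun : modfunctor k C := ModFunctor freefun_map1 freefun_mapM.
End FreeFunctor.

Section FreeMap.
Variables (I : choiceType) (c : I -> C) (A : modfunctor k C).
Variable a : forall i, A (c i).
(* the Yoneda map freefun c -> A determined by the elements a i *)
Definition freefun_lift_comp x : {linear freefun c x -> A x} :=
  flift (fun p : sumhom c x => fmap A (tagged p) (a (tag p))).
Lemma freefun_lift_compE x (p : sumhom c x) :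
  freefun_lift_comp x (fgen k p) = fmap A (tagged p) (a (tag p)).
Proof. exact: flift_gen. Qed.
Lemma freefun_lift_subproof x y (f : hom x y) u :
  freefun_lift_comp y (fmap (freefun c) f u) = fmap A f (freefun_lift_comp x u).
Proof.
rewrite -[LHS]/((freefun_lift_comp y \o fmap (freefun c) f) u).
rewrite -[RHS]/((fmap A f \o freefun_lift_comp x) u).
apply: flift_ext => -[i h].
rewrite -[LHS]/(freefun_lift_comp y (freefun_map c f _)) freefun_mapE.
rewrite -[RHS]/(fmap A f (freefun_lift_comp x _)) !freefun_lift_compE.
exact: fmapM.
Qed.
Definition freefun_lift : nattrans (freefun c) A := NatTrans freefun_lift_subproof.
End FreeMap.

End FunctorConstructions.

Definition pullback_op (k : comPzRingType) (C D : category) (nu : catfunctor C D)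
    (T : modfunctor k (opcat D)) : modfunctor k (opcat C).
Proof.
refine (@ModFunctor k (opcat C) (fun x => T (nu x))
  (fun x y f => fmap T (cmap nu f : @hom (opcat D) _ _)) _ _).
- by move=> x u; rewrite cmap1; exact: (fmap1 (m := T)).
- by move=> x y z g f u; rewrite cmapM; exact: (fmapM (m := T)).
Defined.

Definition nat_surj (k : comPzRingType) (C : category) (A B : modfunctor k C)
  (phi : nattrans A B) := forall x (v : B x), exists u, phi x u = v.

Definition projective (k : comPzRingType) (C : category) (P : modfunctor k C) :=
  forall (A B : modfunctor k C) (phi : nattrans A B) (psi : nattrans P B),
    nat_surj phi ->
  exists chi : nattrans P A, forall x u, phi x (chi x u) = psi x u.

Record proj_resolution (k : comPzRingType) (C : category) (T : modfunctor k C) :=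
  ProjResolution {
    pr_obj :> nat -> modfunctor k C;
    pr_d : forall n, nattrans (pr_obj n.+1) (pr_obj n);
    pr_eps : nattrans (pr_obj 0) T;
    pr_proj : forall n, projective (pr_obj n);
    pr_surj : nat_surj pr_eps;
    pr_exact0 : forall x u, pr_eps x u = 0 <-> exists v, pr_d 0 x v = u;
    pr_exact : forall n x u, pr_d n x u = 0 <-> exists v, pr_d n.+1 x v = u
  }.

Lemma freefun_projective (k : comPzRingType) (C : category) (I : choiceType)
  (c : I -> C) : projective (freefun k c).
Proof.
move=> A B phi psi sphi.
pose e i : sumhom c (c i) := Tagged (fun j => hom (c j) (c i)) (idm (c i)).
pose a i := sval (cid (sphi (c i) (psi (c i) (fgen k (e i))))).
have aE i : phi (c i) (a i) = psi (c i) (fgen k (e i)) by rewrite /a; case: cid.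
exists (freefun_lift a) => x u.
rewrite -[LHS]/((phi x \o freefun_lift a x) u); apply: flift_ext => -[i h].
rewrite -[LHS]/(phi x (freefun_lift_comp _ _ _)) freefun_lift_compE /=.
rewrite ncompN aE -ncompN -[fmap _ _]/(freefun_map _ _ _) freefun_mapE /=.
by rewrite compm1.
Qed.

Section StandardResolution.
Variables (k : comPzRingType) (C : category).

Definition elts (T : modfunctor k C) : choiceType := {c : C & T c}.

(* the free functor on all the elements of T, and its canonical surjection onto T *)
Definition freecover (T : modfunctor k C) : modfunctor k C :=
  freefun k (fun p : elts T => tag p).
Definition freecover_eps (T : modfunctor k C) : nattrans (freecover T) T :=
  freefun_lift (fun p : elts T => tagged p).

Lemma freecover_surj T : nat_surj (freecover_eps T).
Proof.
move=> x v; pose p : elts T := Tagged (fun c => T c : choiceType) v.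
pose q : sumhom (fun p : elts T => tag p) x :=
  Tagged (fun i : elts T => hom (tag i) x) (idm x : hom (tag p) x).
exists (fgen k q); rewrite -[LHS]/(freefun_lift_comp _ _ _).
by rewrite freefun_lift_compE fmap1.
Qed.

Fixpoint syzygy (T : modfunctor k C) (n : nat) : modfunctor k C :=
  if n is n'.+1 then kerfun (freecover_eps (syzygy T n')) else T.

Variable T : modfunctor k C.

Definition std_obj n := freecover (syzygy T n).
Definition std_d n : nattrans (std_obj n.+1) (std_obj n) :=
  natcomp (kerfun_incl (freecover_eps (syzygy T n)))
          (freecover_eps (syzygy T n.+1)).

Lemma std_im n x (u : std_obj n x) :
  freecover_eps (syzygy T n) x u = 0 <-> exists v, std_d n x v = u.
Proof.
split=> [u0|[v <-]]; last by rewrite /= kervalP.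
have uK : u \in in_ker (freecover_eps (syzygy T n) x) by rewrite unfold_in; apply/eqP.
have [v vE] := freecover_surj
  (exist (fun u => u \in in_ker (freecover_eps (syzygy T n) x)) u uK
    : syzygy T n.+1 x).
exists v; exact: (congr1 val vE).
Qed.

Lemma std_exact n x (u : std_obj n.+1 x) :
  std_d n x u = 0 <-> exists v, std_d n.+1 x v = u.
Proof.
rewrite -std_im; split=> [u0|u0].
  by apply: val_inj; rewrite linear0.
exact: (congr1 val u0).
Qed.

Definition std_resolution : proj_resolution T :=
  @ProjResolution k C T std_obj std_d (freecover_eps T)
    (fun n => @freefun_projective k C _ _) (@freecover_surj T)
    (std_im (n := 0)) std_exact.
End StandardResolution.

Section Tensor.
Variables (k : comPzRingType) (C : category).
Variables (T : modfunctor k (opcat C)) (F : modfunctor k C).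

Definition tens_index : choiceType := {c : ob C & (T c * F c)%type}.
Definition tgen (c : C) (x : T c) (y : F c) : freemod k tens_index :=
  fgen k (Tagged (fun c => (T c * F c)%type) (x, y)).

(* the direct sum of the T c (x) F c, modulo f^* x (x) y = x (x) f_* y *)
Inductive tens_rel : freemod k tens_index -> Prop :=
| tens_linl (c : C) a (x x' : T c) (y : F c) :
    tens_rel (tgen (a *: x + x') y - (a *: tgen x y + tgen x' y))
| tens_linr (c : C) a (x : T c) (y y' : F c) :
    tens_rel (tgen x (a *: y + y') - (a *: tgen x y + tgen x y'))
| tens_bal (c d : C) (f : hom c d) (x : T d) (y : F c) :
    tens_rel (tgen (fmap T (f : @hom (opcat C) d c) x) y - tgen x (fmap F f y)).

Definition tensor : lmodType k := quotm tens_rel.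
Definition tens (c : C) (x : T c) (y : F c) : tensor := qpi tens_rel (tgen x y).

Lemma tens_linearl (c : C) a (x x' : T c) (y : F c) :
  tens (a *: x + x') y = a *: tens x y + tens x' y.
Proof. by rewrite /tens -linearP; apply/qpi_eq/span_gen; exact: tens_linl. Qed.

Lemma tens_linearr (c : C) a (x : T c) (y y' : F c) :
  tens x (a *: y + y') = a *: tens x y + tens x y'.
Proof. by rewrite /tens -linearP; apply/qpi_eq/span_gen; exact: tens_linr. Qed.

Lemma tens_balanced (c d : C) (f : hom c d) (x : T d) (y : F c) :
  tens (fmap T (f : @hom (opcat C) d c) x) y = tens x (fmap F f y).
Proof. by apply/qpi_eq/span_gen; exact: tens_bal. Qed.
End Tensor.

Section TensorMap.
Variables (k : comPzRingType) (C : category).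
Variables (T T' : modfunctor k (opcat C)) (F : modfunctor k C).
Variable phi : nattrans T T'.

Definition tensor_map_free : {linear freemod k (tens_index T F) -> tensor T' F} :=
  flift (fun p : tens_index T F =>
    tens (phi (tag p) (tagged p).1) (tagged p).2).

Lemma tensor_map_freeE (c : C) (x : T c) (y : F c) :
  tensor_map_free (tgen x y) = tens (phi c x) y.
Proof. exact: flift_gen. Qed.

Lemma tensor_map_subproof v : @tens_rel k C T F v -> tensor_map_free v = 0.
Proof.
case=> [c a x x' y|c a x y y'|c d f x y];
  apply/eqP; rewrite linearB subr_eq0 ?linearP !tensor_map_freeE; apply/eqP.
- by rewrite linearP tens_linearl.
- by rewrite tens_linearr.
- by rewrite (ncompN phi (f : @hom (opcat C) d c)) tens_balanced.
Qed.
Definition tensor_map : {linear tensor T F -> tensor T' F} :=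
  qlift tensor_map_subproof.

Lemma tensor_mapE (c : C) (x : T c) (y : F c) :
  tensor_map (tens x y) = tens (phi c x) y.
Proof. by rewrite qliftE tensor_map_freeE. Qed.

Lemma tensor_ext (W : lmodType k) (f g : {linear tensor T F -> W}) :
  (forall (c : C) (x : T c) (y : F c), f (tens x y) = g (tens x y)) -> f =1 g.
Proof.
move=> fg u; have [v <-] := qpi_surj u.
rewrite -[LHS]/((f \o qpi _) v) -[RHS]/((g \o qpi _) v).
by apply: flift_ext => -[c [x y]]; exact: fg.
Qed.
End TensorMap.

(** The homology of ... -> M 2 -> M 1 -> M 0 -> 0 *)
Section Homology.
Variables (k : comPzRingType) (M : nat -> lmodType k).
Variable d : forall n, {linear M n.+1 -> M n}.

Definition dout n : {linear M n -> M n.-1} :=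
  match n return {linear M n -> M n.-1} with
  | 0 => \0 : {linear M 0 -> M 0}
  | n'.+1 => d n'
  end.

Definition homology n : lmodType k :=
  quotm (fun z : kermod (dout n) => exists u, d n u = val z).
End Homology.

Lemma TorR_dd (k : comPzRingType) (C : category) (T : modfunctor k (opcat C))
    (P : proj_resolution T) (F : modfunctor k C) n u :
  tensor_map F (pr_d P n) (tensor_map F (pr_d P n.+1) u) = 0.
Proof.
rewrite -[LHS]/((tensor_map F (pr_d P n) \o tensor_map F (pr_d P n.+1)) u).
rewrite -[RHS]/((\0 : {linear _ -> tensor (P n) F}) u).
apply: (@tensor_ext _ _ (P n.+2)) => c x y.
rewrite -[LHS]/(tensor_map F (pr_d P n) (tensor_map F (pr_d P n.+1) _)) !tensor_mapE.
have -> : pr_d P n c (pr_d P n.+1 c x) = 0 by apply/pr_exact; exists x.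
by have := tens_linearl (-1) (0 : P n c) 0 y; rewrite scaler0 addr0 scaleN1r addNr.
Qed.

(* L_n(- (x)_C F)(T), computed with the resolution P of T *)
Definition TorR (k : comPzRingType) (C : category) (T : modfunctor k (opcat C))
    (P : proj_resolution T) (n : nat) (F : modfunctor k C) : lmodType k :=
  homology (fun i => tensor_map F (pr_d P i)) n.

Definition Tor (k : comPzRingType) (C : category) (n : nat)
    (T : modfunctor k (opcat C)) (F : modfunctor k C) : lmodType k :=
  TorR (std_resolution T) n F.

(* the object n of both categories is {0, ..., n} *)

Definition fin_comp (m n p : nat) (g : {ffun 'I_n.+1 -> 'I_p.+1})
  (f : {ffun 'I_m.+1 -> 'I_n.+1}) : {ffun 'I_m.+1 -> 'I_p.+1} :=
  [ffun i => g (f i)].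
Definition fin_id (n : nat) : {ffun 'I_n.+1 -> 'I_n.+1} := [ffun i => i].

Lemma fin_comp1m m n (f : {ffun 'I_m.+1 -> 'I_n.+1}) : fin_comp (fin_id n) f = f.
Proof. by apply/ffunP => i; rewrite !ffunE. Qed.
Lemma fin_compm1 m n (f : {ffun 'I_m.+1 -> 'I_n.+1}) : fin_comp f (fin_id m) = f.
Proof. by apply/ffunP => i; rewrite !ffunE. Qed.
Lemma fin_compA m n p q (h : {ffun 'I_p.+1 -> 'I_q.+1})
    (g : {ffun 'I_n.+1 -> 'I_p.+1}) (f : {ffun 'I_m.+1 -> 'I_n.+1}) :
  fin_comp h (fin_comp g f) = fin_comp (fin_comp h g) f.
Proof. by apply/ffunP => i; rewrite !ffunE. Qed.

Definition Fcat : category :=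
  @Category nat (fun m n => {ffun 'I_m.+1 -> 'I_n.+1}) fin_id fin_comp
    fin_comp1m fin_compm1 fin_compA.

Definition pointed_map (m n : nat) : choiceType :=
  {f : {ffun 'I_m.+1 -> 'I_n.+1} | f ord0 == ord0}.

Lemma pointed_id_subproof n : fin_id n ord0 == ord0.
Proof. by rewrite ffunE. Qed.
Definition pointed_id n : pointed_map n n := exist _ (fin_id n) (pointed_id_subproof n).

Lemma pointed_comp_subproof m n p (g : pointed_map n p) (f : pointed_map m n) :
  fin_comp (val g) (val f) ord0 == ord0.
Proof. by rewrite ffunE (eqP (valP f)) (eqP (valP g)). Qed.
Definition pointed_comp m n p (g : pointed_map n p) (f : pointed_map m n) :
    pointed_map m p :=
  exist _ (fin_comp (val g) (val f)) (pointed_comp_subproof g f).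

Lemma pointed_comp1m m n (f : pointed_map m n) : pointed_comp (pointed_id n) f = f.
Proof. by apply: val_inj; exact: fin_comp1m. Qed.
Lemma pointed_compm1 m n (f : pointed_map m n) : pointed_comp f (pointed_id m) = f.
Proof. by apply: val_inj; exact: fin_compm1. Qed.
Lemma pointed_compA m n p q (h : pointed_map p q) (g : pointed_map n p)
    (f : pointed_map m n) :
  pointed_comp h (pointed_comp g f) = pointed_comp (pointed_comp h g) f.
Proof. by apply: val_inj; exact: fin_compA. Qed.

Definition Gcat : category :=
  @Category nat pointed_map pointed_id pointed_comp
    pointed_comp1m pointed_compm1 pointed_compA.

(* the new basepoint is 0, and i in {0, ..., m} becomes i + 1 in [m + 1] *)
Definition nu_fun (m n : nat) (f : {ffun 'I_m.+1 -> 'I_n.+1}) :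
    {ffun 'I_m.+2 -> 'I_n.+2} :=
  [ffun i => if unlift ord0 i is Some j then lift ord0 (f j) else ord0].

Lemma nu_fun0 m n (f : {ffun 'I_m.+1 -> 'I_n.+1}) : nu_fun f ord0 == ord0.
Proof. by rewrite ffunE unlift_none. Qed.
Definition nu_map (m n : nat) (f : {ffun 'I_m.+1 -> 'I_n.+1}) :
    pointed_map m.+1 n.+1 :=
  exist _ (nu_fun f) (nu_fun0 f).

Lemma nu_map1 m : nu_map (fin_id m) = pointed_id m.+1.
Proof.
apply: val_inj; apply/ffunP => i; rewrite !ffunE.
by case: unliftP => [j ->|->]; rewrite ?ffunE.
Qed.
Lemma nu_mapM m n p (g : {ffun 'I_n.+1 -> 'I_p.+1})
    (f : {ffun 'I_m.+1 -> 'I_n.+1}) :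
  nu_map (fin_comp g f) = pointed_comp (nu_map g) (nu_map f).
Proof.
apply: val_inj; apply/ffunP => i; rewrite !ffunE.
by case: (unlift ord0 i) => [j|]; rewrite ?liftK ?unlift_none ?ffunE.
Qed.

Definition nu : catfunctor Fcat Gcat :=
  @CatFunctor Fcat Gcat (fun m => m.+1) nu_map nu_map1 nu_mapM.

Section CyclicGamma.
Variable k : comPzRingType.

Definition based : forall n, {pred {ffun 'I_n.+1 -> k^o}} := fun n f => f ord0 == 0.
Lemma based_submod n : GRing.submod_closed (@based n).
Proof.
split=> [|a u v]; rewrite !unfold_in !ffunE ?eqxx// => /eqP -> /eqP ->.
by rewrite scaler0 addr0.
Qed.
HB.instance Definition _ n :=
  GRing.isSubmodClosed.Build k {ffun 'I_n.+1 -> k^o} (@based n) (@based_submod n).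

Definition pointed_fun (n : nat) := {f : {ffun 'I_n.+1 -> k^o} | f \in @based n}.
HB.instance Definition _ n := SubChoice.on (pointed_fun n).
HB.instance Definition _ n := [SubChoice_isSubLmodule of pointed_fun n by <:].

Lemma t_map_subproof m n (f : pointed_map m n) (u : pointed_fun n) :
  [ffun i => val u (val f i)] \in @based m.
Proof. by rewrite unfold_in ffunE (eqP (valP f)); exact: (valP u). Qed.
Definition t_map_fun m n (f : pointed_map m n) (u : pointed_fun n) : pointed_fun m :=
  exist (fun f => f \in @based m) _ (t_map_subproof f u).
Lemma t_map_linear m n (f : pointed_map m n) : linear (t_map_fun f).
Proof. by move=> a u v; apply: val_inj; apply/ffunP => i; rewrite /= !ffunE. Qed.
HB.instance Definition _ m n (f : pointed_map m n) :=
  GRing.isLinear.Build k (pointed_fun n) (pointed_fun m) _ (t_map_fun f)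
    (t_map_linear f).
Definition t_map m n (f : pointed_map m n) :
  {linear pointed_fun n -> pointed_fun m} := t_map_fun f.
Lemma t_map1 n u : t_map (pointed_id n) u = u.
Proof. by apply: val_inj; apply/ffunP => i; rewrite /= !ffunE. Qed.
Lemma t_mapM m n p (g : pointed_map m n) (f : pointed_map n p) u :
  t_map (pointed_comp f g) u = t_map g (t_map f u).
Proof. by apply: val_inj; apply/ffunP => i; rewrite /= !ffunE. Qed.

Definition t : modfunctor k (opcat Gcat) :=
  @ModFunctor k (opcat Gcat) pointed_fun (fun m n f => t_map f)
    t_map1 (fun m n p g f u => t_mapM g f u).

Definition nu_t : modfunctor k (opcat Fcat) := pullback_op nu t.

Definition F0_map m n (f : {ffun 'I_m.+1 -> 'I_n.+1}) :
    {linear freemod k {ffun 'I_n.+1 -> 'I_1} -> freemod k {ffun 'I_m.+1 -> 'I_1}} :=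
  flift (fun h => fgen k (fin_comp h f)).
Lemma F0_mapE m n (f : {ffun 'I_m.+1 -> 'I_n.+1}) h :
  F0_map f (fgen k h) = fgen k (fin_comp h f).
Proof. exact: flift_gen. Qed.
Lemma F0_map1 n u : F0_map (fin_id n) u = u.
Proof.
rewrite [RHS](freemodE u); apply: flift_ext => h.
by rewrite flift_gen F0_mapE fin_compm1.
Qed.
Lemma F0_mapM m n p (g : {ffun 'I_m.+1 -> 'I_n.+1}) (f : {ffun 'I_n.+1 -> 'I_p.+1}) u :
  F0_map (fin_comp f g) u = F0_map g (F0_map f u).
Proof.
rewrite -[RHS]/((F0_map g \o F0_map f) u); apply: flift_ext => h.
by rewrite -[RHS]/(F0_map g (F0_map f _)) !F0_mapE fin_compA.
Qed.
Definition F0 : modfunctor k (opcat Fcat) :=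
  @ModFunctor k (opcat Fcat)
    (fun n => freemod k {ffun 'I_n.+1 -> 'I_1}) (fun m n f => F0_map f)
    F0_map1 (fun m n p g f u => F0_mapM g f u).

Lemma one_off_base_subproof n : [ffun i : 'I_n.+2 => (i != ord0)%:R] \in @based n.+1.
Proof. by rewrite unfold_in ffunE eqxx. Qed.
(* the function on [n + 1] with value 1 on 1, ..., n + 1 *)
Definition one_off_base n : pointed_fun n.+1 :=
  exist (fun f => f \in @based n.+1) _ (one_off_base_subproof n).

Definition F0_to_nu_t_comp n :
    {linear freemod k {ffun 'I_n.+1 -> 'I_1} -> pointed_fun n.+1} :=
  flift (fun=> one_off_base n).
Lemma F0_to_nu_t_subproof m n (f : {ffun 'I_m.+1 -> 'I_n.+1}) u :
  F0_to_nu_t_comp m (F0_map f u) = t_map (nu_map f) (F0_to_nu_t_comp n u).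
Proof.
rewrite -[LHS]/((F0_to_nu_t_comp m \o F0_map f) u).
rewrite -[RHS]/((t_map (nu_map f) \o F0_to_nu_t_comp n) u); apply: flift_ext => h.
rewrite -[LHS]/(F0_to_nu_t_comp m (F0_map f _)) F0_mapE flift_gen.
rewrite -[RHS]/(t_map (nu_map f) (F0_to_nu_t_comp n _)) flift_gen.
apply: val_inj; apply/ffunP => i; rewrite /= !ffunE.
by case: unliftP => [j ->|->]; rewrite ?eqxx// !(eq_sym _ ord0) !neq_lift.
Qed.
Definition F0_to_nu_t : nattrans F0 nu_t :=
  @NatTrans k (opcat Fcat) F0 nu_t F0_to_nu_t_comp
    (fun m n f u => F0_to_nu_t_subproof f u).

(* hence 0 -> F0 -> nu^* t -> tbar -> 0 is exact *)
Lemma F0_to_nu_t_inj n : injective (F0_to_nu_t n).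
Proof.
move=> u v; pose h0 : {ffun 'I_n.+1 -> 'I_1} := [ffun=> ord0].
have hE h : h = h0 by apply/ffunP => i; rewrite ffunE ord1.
have E w : val (F0_to_nu_t n w) (lift ord0 ord0) = val w h0.
  rewrite -[F0_to_nu_t n w]/(flift_fun _ _) (@flift_funE _ _ _ _ _ [:: h0])//.
    rewrite big_seq1 -[LHS]/((val w h0 *: val (one_off_base n)) _) ffunE /= ffunE.
    by rewrite eq_sym neq_lift; exact: mulr1.
  by move=> h; rewrite (hE h) mem_head.
move=> uv; apply: val_inj; apply/funext => h.
by rewrite (hE h) -!E uv.
Qed.

Definition tbar : modfunctor k (opcat Fcat) := cokerfun F0_to_nu_t.

Definition HGammaC (n : nat) (F : modfunctor k Fcat) : lmodType k := Tor n tbar F.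

End CyclicGamma.

(* d_i on {0, ..., n + 1}; for i <= n + 1 the argument of inord is at most n *)
Definition face (n i : nat) : {ffun 'I_n.+2 -> 'I_n.+1} :=
  [ffun j : 'I_n.+2 =>
    inord (if (i < n.+1)%N then unbump i j else if j == n.+1 :> nat then 0%N else j)].

Definition cycperm (n : nat) : {ffun 'I_n.+1 -> 'I_n.+1} := [ffun i => ordS i].

Definition shift (n : nat) : {ffun 'I_n.+1 -> 'I_n.+2} := [ffun i => lift ord0 i].

Section CyclicHomology.
Variables (k : comPzRingType) (F : modfunctor k Fcat).

Local Notation act f := (@fmap k Fcat F _ _ f).

Definition hoch_b (n : nat) (u : F n.+1) : F n :=
  \sum_(i < n.+2) (-1) ^+ i *: act (face n i) u.

Definition cyc_t (n : nat) (u : F n) : F n := (-1) ^+ n *: act (cycperm n) u.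

Definition cyc_N (n : nat) (u : F n) : F n :=
  \sum_(1 <= i < n.+2) iter i (@cyc_t n) u.

Definition connes_B (n : nat) (u : F n) : F n.+1 :=
  let v := act (shift n) (cyc_N u) in v - cyc_t v.

Lemma hoch_b_linear n : linear (@hoch_b n).
Proof.
move=> a u v; rewrite /hoch_b scaler_sumr -big_split; apply: eq_bigr => i _ /=.
by rewrite linearP scalerDr !scalerA mulrC.
Qed.
HB.instance Definition _ n :=
  GRing.isLinear.Build k (F n.+1) (F n) _ (@hoch_b n) (@hoch_b_linear n).

Lemma cyc_t_linear n : linear (@cyc_t n).
Proof. by move=> a u v; rewrite /cyc_t linearP scalerDr !scalerA mulrC. Qed.
HB.instance Definition _ n :=
  GRing.isLinear.Build k (F n) (F n) _ (@cyc_t n) (@cyc_t_linear n).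

Lemma cyc_N_linear n : linear (@cyc_N n).
Proof.
move=> a u v; rewrite /cyc_N scaler_sumr -big_split; apply: eq_bigr => i _ /=.
by elim: i => [|i IH]; rewrite ?iterS ?IH ?linearP.
Qed.
HB.instance Definition _ n :=
  GRing.isLinear.Build k (F n) (F n) _ (@cyc_N n) (@cyc_N_linear n).

Lemma connes_B_linear n : linear (@connes_B n).
Proof.
move=> a u v; by rewrite /connes_B !linearP scalerDr addrACA.
Qed.
HB.instance Definition _ n :=
  GRing.isLinear.Build k (F n) (F n.+1) _ (@connes_B n) (@connes_B_linear n).

(* F n (+) F (n - 2) (+) F (n - 4) (+) ... *)
Fixpoint tot (n : nat) : lmodType k :=
  match n with
  | 0 => F 0
  | 1 => F 1
  | n'.+2 => (F n'.+2 * tot n')%type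
  end.

Definition tot_head (n : nat) : tot n -> F n :=
  match n return tot n -> F n with
  | 0 => id
  | 1 => id
  | n'.+2 => fst
  end.

(* b + B; the component in F (n - 2j) of the image of (x_0, x_1, ...), where x_j lies
   in F (n + 1 - 2j), is b x_j + B x_(j+1), with b x_j = 0 if x_j lies in F 0 *)
Fixpoint tot_d (n : nat) : tot n.+1 -> tot n :=
  match n return tot n.+1 -> tot n with
  | 0 => @hoch_b 0
  | 1 => fun x => hoch_b x.1 + connes_B x.2
  | n'.+2 => fun x : F n'.+3 * tot n'.+1 =>
      (hoch_b x.1 + connes_B (@tot_head n'.+1 x.2), @tot_d n' x.2)
  end.

Lemma tot_head_linear n : linear (@tot_head n).
Proof. by case: n => [|[|n]]. Qed.

Lemma pair_linear (V W : lmodType k) a (x x' y y' : V) (z z' : W) :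
  ((a *: x + x') + (a *: y + y'), a *: z + z') = a *: (x + y, z) + (x' + y', z').
Proof. by rewrite addrACA -scalerDr. Qed.

Lemma tot_d_linear n : linear (@tot_d n).
Proof.
elim/ltn_ind: n => -[|[|n]] IH a u v /=; first exact: linearP.
  by rewrite !linearP scalerDr addrACA.
have step (u1 v1 : F n.+3) (u2 v2 : tot n.+1) :
    (hoch_b (a *: u1 + v1) + connes_B (tot_head (a *: u2 + v2)), tot_d (a *: u2 + v2)) =
    a *: (hoch_b u1 + connes_B (tot_head u2), tot_d u2) +
    (hoch_b v1 + connes_B (tot_head v2), tot_d v2).
  rewrite tot_head_linear !linearP (IH n)//.
  exact: pair_linear.
exact: step.
Qed.
HB.instance Definition _ n :=
  GRing.isLinear.Build k (tot n.+1) (tot n) _ (@tot_d n) (@tot_d_linear n).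

Definition HC (n : nat) : lmodType k :=
  homology (fun i => @tot_d i : {linear tot i.+1 -> tot i}) n.

End CyclicHomology.

(* A k-algebra is given by its unit map eta : k -> A, so that the zero algebra (and
   k = 0) is allowed; the scalar action is a . x = eta a * x *)
Section Loday.
Variables (k A : comPzRingType) (eta : {rmorphism k -> A}).

Definition upd (n : nat) (a : {ffun 'I_n.+1 -> A}) (i : 'I_n.+1) (x : A) :
    {ffun 'I_n.+1 -> A} :=
  [ffun j => if j == i then x else a j].

Inductive tpow_rel (n : nat) : freemod k {ffun 'I_n.+1 -> A} -> Prop :=
| TPowRel (a : {ffun 'I_n.+1 -> A}) i (c : k) (x y : A) :
    tpow_rel (fgen k (upd a i (eta c * x + y))
              - (c *: fgen k (upd a i x) + fgen k (upd a i y))).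

(* the (n + 1)-st tensor power of A over k *)
Definition tpow (n : nat) : lmodType k := quotm (@tpow_rel n).
Definition ptens (n : nat) (a : {ffun 'I_n.+1 -> A}) : tpow n :=
  qpi (@tpow_rel n) (fgen k a).

Lemma ptens_linear n (a : {ffun 'I_n.+1 -> A}) i c x y :
  ptens (upd a i (eta c * x + y)) = c *: ptens (upd a i x) + ptens (upd a i y).
Proof. by rewrite /ptens -linearP; apply/qpi_eq/span_gen. Qed.

Definition fiber_prod (m n : nat) (f : {ffun 'I_m.+1 -> 'I_n.+1})
    (a : {ffun 'I_m.+1 -> A}) : {ffun 'I_n.+1 -> A} :=
  [ffun i => \prod_(j | f j == i) a j].

Lemma fiber_prod_upd m n (f : {ffun 'I_m.+1 -> 'I_n.+1}) a i x :
  fiber_prod f (upd a i x) =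
  upd (fiber_prod f a) (f i) (x * \prod_(j | (f j == f i) && (j != i)) a j).
Proof.
apply/ffunP => l; rewrite !ffunE; case: eqP => [->|/eqP li].
  rewrite (bigD1 i)//= ffunE eqxx; congr (_ * _).
  by apply: eq_bigr => j /andP[_ /negPf ji]; rewrite ffunE ji.
apply: eq_bigr => j /eqP fj; rewrite ffunE; case: eqP => // ji.
by rewrite -fj ji eqxx in li.
Qed.

Definition loday_free m n (f : {ffun 'I_m.+1 -> 'I_n.+1}) :
    {linear freemod k {ffun 'I_m.+1 -> A} -> tpow n} :=
  flift (fun a => ptens (fiber_prod f a)).

Lemma loday_subproof m n (f : {ffun 'I_m.+1 -> 'I_n.+1}) v :
  tpow_rel v -> loday_free f v = 0.
Proof.
case=> a i c x y; apply/eqP; rewrite linearB subr_eq0 linearP !flift_gen.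
by rewrite !fiber_prod_upd mulrDl -mulrA ptens_linear.
Qed.
Definition loday_map m n (f : {ffun 'I_m.+1 -> 'I_n.+1}) :
  {linear tpow m -> tpow n} := qlift (@loday_subproof m n f).

Lemma loday_mapE m n (f : {ffun 'I_m.+1 -> 'I_n.+1}) a :
  loday_map f (ptens a) = ptens (fiber_prod f a).
Proof. by rewrite qliftE flift_gen. Qed.

Lemma tpow_ext n (W : lmodType k) (f g : {linear tpow n -> W}) :
  (forall a, f (ptens a) = g (ptens a)) -> f =1 g.
Proof.
move=> fg u; have [v <-] := qpi_surj u.
by rewrite -[LHS]/((f \o qpi _) v) -[RHS]/((g \o qpi _) v); apply: flift_ext.
Qed.

Lemma loday_map1 n u : loday_map (fin_id n) u = u.
Proof.
rewrite -[RHS]/((idfun : {linear tpow n -> tpow n}) u); apply: tpow_ext => a.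
rewrite loday_mapE; congr ptens; apply/ffunP => i; rewrite ffunE.
by rewrite (eq_bigl (pred1 i)) ?big_pred1_eq// => j; rewrite ffunE.
Qed.

Lemma loday_mapM m n p (g : {ffun 'I_n.+1 -> 'I_p.+1})
    (f : {ffun 'I_m.+1 -> 'I_n.+1}) u :
  loday_map (fin_comp g f) u = loday_map g (loday_map f u).
Proof.
rewrite -[RHS]/((loday_map g \o loday_map f) u); apply: tpow_ext => a.
rewrite -[RHS]/(loday_map g (loday_map f _)) !loday_mapE.
congr ptens; apply/ffunP => i; rewrite !ffunE.
rewrite (partition_big f (fun j => g j == i)) => [|j]; last by rewrite ffunE.
apply: eq_bigr => j /eqP gj; rewrite ffunE; apply: eq_bigl => l.
by rewrite ffunE; case: (f l =P j) => [->|]; rewrite ?gj ?eqxx ?andbF.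
Qed.

Definition Loday : modfunctor k Fcat :=
  @ModFunctor k Fcat tpow (fun m n f => loday_map f) loday_map1
    (fun m n p g f u => loday_mapM g f u).

Definition HGammaC_alg (n : nat) : lmodType k := HGammaC n Loday.
Definition HC_alg (n : nat) : lmodType k := HC Loday n.

End Loday.

(* Main.v *)
(** In degree zero Tor is the tensor product [tbar (x) F], by right exactness.
    The functor [nu^* t] is spanned by characteristic functions of subsets, hence is a
    quotient of the functor represented by {0, 1}, and its relations come from the
    identity [chi_(S u T) = chi_S + chi_T] for disjoint S and T, i.e. from maps to
    {0, 1, 2}; passing to [tbar] adds the relation [chi_everything = 0].  So
    [tbar (x) F] is [F 1] modulo [b (F 2)], where [b = p_T - p_(S u T) + p_S] with
    S = {1} and T = {2}, and modulo the image of [F 0] under 0 |-> 1.  Now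
    [b : F 1 -> F 0] vanishes and [B : F 0 -> F 1] is the sum of the maps induced by
    0 |-> 1 and 0 |-> 0.  The image of the latter lies in [b (F 2)] (take S and T
    empty), so this quotient is [HC_1 F]. *)

From HB Require Import structures.
Require Import Defs.
From mathcomp Require Import all_boot all_algebra.
From mathcomp Require Import boolp.
(* [hom] and [span] are also names of the MathComp vector library. *)
Import Defs.

Set Implicit Arguments.
Unset Strict Implicit.
Unset Printing Implicit Defensive.

Import GRing.Theory.
Local Open Scope ring_scope.

(** * Preliminaries on isomorphisms and quotients *)

Section LinearIsomorphisms.
Variable k : comPzRingType.
Implicit Types U V W : lmodType k.

Lemma lmod_iso_cancel V W (f : {linear V -> W}) (g : W -> V) :
  cancel f g -> cancel g f -> lmod_iso V W.
Proof. by move=> fK gK; exists f; exists g. Qed.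

Lemma lmod_iso_trans U V W : lmod_iso U V -> lmod_iso V W -> lmod_iso U W.
Proof. by move=> [f bf] [g bg]; exists (g \o f); exact: bij_comp. Qed.

Lemma qpi_eq0 V (S : V -> Prop) v : qpi S v = 0 <-> span S v.
Proof. by rewrite -(linear0 (qpi S)) qpi_eq subr0. Qed.
End LinearIsomorphisms.

Lemma tens0l (k : comPzRingType) (C : category) (T : modfunctor k (opcat C))
  (F : modfunctor k C) (c : C) (y : F c) : tens (0 : T c) y = 0.
Proof.
by have := tens_linearl (-1) (0 : T c) 0 y; rewrite scaler0 addr0 scaleN1r addNr.
Qed.

(** * The universal property of the tensor product of functors *)

Section TensorUniversal.
Variables (k : comPzRingType) (C : category).
Variables (T : modfunctor k (opcat C)) (F : modfunctor k C) (W : lmodType k).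
Variable beta : forall c : C, T c -> F c -> W.
Hypothesis beta_linl : forall c (y : F c), linear (fun x : T c => beta x y).
Hypothesis beta_linr : forall c (x : T c), linear (beta x).
Hypothesis beta_bal : forall (c d : C) (f : hom c d) (x : T d) (y : F c),
  beta (fmap T (f : @hom (opcat C) d c) x) y = beta x (fmap F f y).

Lemma tensor_univ :
  exists g : {linear tensor T F -> W},
    forall (c : C) (x : T c) (y : F c), g (tens x y) = beta x y.
Proof.
pose h : {linear freemod k (tens_index T F) -> W} :=
  flift (fun p : tens_index T F => beta (tagged p).1 (tagged p).2).
have hE c (x : T c) (y : F c) : h (tgen x y) = beta x y by exact: flift_gen.
have h0 v : @tens_rel k C T F v -> h v = 0.
  case=> [c a x x' y|c a x y y'|c d f x y];
    apply/eqP; rewrite linearB subr_eq0 ?linearP !hE; apply/eqP.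
  - exact: beta_linl.
  - exact: beta_linr.
  - exact: beta_bal.
by exists (qlift h0) => c x y; rewrite qliftE hE.
Qed.
End TensorUniversal.

(** * Degree-zero Tor as a tensor product *)

Section RightExactness.
Variables (k : comPzRingType) (C : category) (T : modfunctor k (opcat C)).
Variables (P : proj_resolution T) (F : modfunctor k C).

Local Notation d := (fun i => tensor_map F (pr_d P i)).

Lemma dout0_tensor (u : tensor (P 0) F) : dout d 0 (idfun u) = 0.
Proof. by []. Qed.

Definition TorR0_class : {linear tensor (P 0) F -> TorR P 0 F} :=
  qpi _ \o kercor dout0_tensor.

Lemma TorR0_class_bdry u : TorR0_class (d 0 u) = 0.
Proof. by apply/qpi_eq0/span_gen; exists u. Qed.

(** The inverse lifts x along the surjection [pr_eps] and takes the class of the lift. By exactness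
    two lifts differ by a boundary, so the class depends on x alone; hence it is linear and balanced
    although the chosen lifts need not be. *)
Lemma TorR0_iso : lmod_iso (TorR P 0 F) (tensor T F).
Proof.
pose lft c (x : T c) : P 0 c := sval (cid (pr_surj P x)).
have lftK c (x : T c) : pr_eps P c (lft c x) = x by rewrite /lft; case: cid.
pose cls c (z : P 0 c) (y : F c) := TorR0_class (tens z y).
have clsP c (y : F c) : linear (fun z : P 0 c => cls c z y).
  by move=> a u v; rewrite /cls tens_linearl linearP.
have cls_eps c (z z' : P 0 c) (y : F c) :
    pr_eps P c z = pr_eps P c z' -> cls c z y = cls c z' y.
  move=> zz'; have /pr_exact0 [w wE] : pr_eps P c (z - z') = 0.
    by rewrite linearB zz' subrr.
  (* The scalar 1 gives the sum the shape that [clsP] expands. *)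
  have -> : z = 1 *: pr_d P 0 c w + z' by rewrite wE scale1r subrK.
  by rewrite clsP scale1r {1}/cls -tensor_mapE TorR0_class_bdry add0r.
have [g gE] : exists g : {linear tensor T F -> TorR P 0 F},
    forall c (x : T c) (y : F c), g (tens x y) = cls c (lft c x) y.
  apply: tensor_univ => [c y a u v|c x a u v|c c' f x y].
  - rewrite -clsP; apply: cls_eps.
    by rewrite lftK linearP !lftK.
  - by rewrite /cls tens_linearr linearP.
  - rewrite /cls -tens_balanced; apply: cls_eps.
    by rewrite lftK ncompN lftK.
have eps0 (z : kermod (dout d 0)) : (exists u, d 0%N u = val z) ->
    (tensor_map F (pr_eps P) \o kerval _) z = 0.
  move=> [u uz]; rewrite /= -uz.
  rewrite -[LHS]/((tensor_map F (pr_eps P) \o tensor_map F (pr_d P 0)) u).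
  rewrite -[RHS]/((\0 : {linear _ -> tensor T F}) u).
  apply: (@tensor_ext _ _ (P 1)) => c x y.
  rewrite -[LHS]/(tensor_map F (pr_eps P) (tensor_map F (pr_d P 0) _)) !tensor_mapE.
  have -> : pr_eps P c (pr_d P 0 c x) = 0 by apply/pr_exact0; exists x.
  exact: tens0l.
pose h : {linear TorR P 0 F -> tensor T F} := qlift eps0.
have hE u : h (TorR0_class u) = tensor_map F (pr_eps P) u by exact: qliftE.
apply: (@lmod_iso_cancel _ _ _ h g).
  move=> x; have [z <-] := qpi_surj x.
  have -> : qpi _ z = TorR0_class (val z).
    by rewrite /=; congr (qpi _ _); apply: val_inj.
  rewrite hE -[LHS]/((g \o tensor_map F (pr_eps P)) (val z)).
  apply: tensor_ext => c u y.
  by rewrite -[LHS]/(g (tensor_map _ _ _)) tensor_mapE gE; apply: cls_eps; rewrite lftK.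
move=> u; rewrite -[LHS]/((h \o g) u) -[RHS]/((idfun : {linear _ -> _}) u).
by apply: tensor_ext => c x y; rewrite -[LHS]/(h (g _)) gE hE tensor_mapE lftK.
Qed.
End RightExactness.

(** * Indicator maps and the operators b and B in low degrees *)

Section DegreeOne.
Variable k : comPzRingType.

Definition indic m (S : pred 'I_m.+1) : {ffun 'I_m.+1 -> 'I_2} :=
  [ffun i => if S i then ord_max else ord0].

Definition collapse2 m (S T : pred 'I_m.+1) : {ffun 'I_m.+1 -> 'I_3} :=
  [ffun i => if S i then inord 1 else if T i then ord_max else ord0].

Lemma indic_comp m n (f : {ffun 'I_m.+1 -> 'I_n.+1}) (S : pred 'I_n.+1) :
  fin_comp (indic S) f = indic (fun i => S (f i)).
Proof. by apply/ffunP => i; rewrite !ffunE. Qed.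

Lemma eq_indic m (S T : pred 'I_m.+1) : S =1 T -> indic S = indic T.
Proof. by move=> ST; apply/ffunP => i; rewrite !ffunE ST. Qed.

(** The faces 0, 1 and 2 merge the values 0 and 1, 1 and 2, and 0 and 2 respectively. *)
Lemma face_collapse2 m (S T : pred 'I_m.+1) : (forall i, S i -> ~~ T i) ->
  [/\ fin_comp (face 1 0) (collapse2 S T) = indic T,
      fin_comp (face 1 1) (collapse2 S T) = indic (predU S T) &
      fin_comp (face 1 2) (collapse2 S T) = indic S].
Proof.
move=> ST; split; apply/ffunP => i; rewrite !ffunE /=;
  case: (S i) (ST i); case: (T i) => /= STi; apply: val_inj => /=;
  by rewrite ?inordK //= ?inordK //; have := STi isT.
Qed.

Variable F : modfunctor k Fcat.

Local Notation act f := (@fmap k Fcat F _ _ f).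

Lemma act_comp m n p (g : {ffun 'I_n.+1 -> 'I_p.+1}) (f : {ffun 'I_m.+1 -> 'I_n.+1}) u :
  act g (act f u) = act (fin_comp g f) u.
Proof. by rewrite -fmapM. Qed.

(** Both faces map to a one-point set, so they coincide and cancel. *)
Lemma hoch_b0 (u : F 1%N) : hoch_b u = 0.
Proof.
rewrite /hoch_b !big_ord_recl big_ord0 addr0 expr0 scale1r /= expr1 scaleN1r.
rewrite (_ : face 0 _ = face 0 0) ?subrr//.
by apply/ffunP => i; rewrite !ord1.
Qed.

Lemma hoch_b_collapse2 m (S T : pred 'I_m.+1) y : (forall i, S i -> ~~ T i) ->
  hoch_b (act (collapse2 S T) y) =
  act (indic T) y - act (indic (predU S T)) y + act (indic S) y.
Proof.
move=> /face_collapse2[f0 f1 f2].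
rewrite /hoch_b !big_ord_recl big_ord0 addr0 /= /bump /= expr0 scale1r.
by rewrite expr1 scaleN1r sqrrN expr1n scale1r !act_comp f0 f1 f2 addrA.
Qed.

(** N is the identity on [F 0]. The sign of t on [F 1] turns 1 - t into a sum, and the rotation
    takes 0 |-> 1 to 0 |-> 0. *)
Lemma connes_B0 (z : F 0%N) :
  connes_B z = act (indic predT) z + act (indic pred0) z.
Proof.
have cyc_Nz : cyc_N z = z.
  rewrite /cyc_N big_nat1 /= /cyc_t expr0 scale1r -[RHS]fmap1.
  by congr (act _ z); apply/ffunP => i; rewrite !ord1.
rewrite /connes_B cyc_Nz /cyc_t expr1 scaleN1r opprK act_comp.
congr (act _ z + act _ z); apply/ffunP => i; rewrite !ffunE;
  by apply: val_inj; rewrite /= ord1.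
Qed.

(** * Maps out of [F 1] killed by b and B extend to tbar (x) F *)

Section CyclicCocycle.
Variables (W : lmodType k) (cls : {linear F 1%N -> W}).
Hypothesis cls_b : forall u, cls (hoch_b u) = 0.
Hypothesis cls_B : forall u, cls (connes_B u) = 0.

Lemma cocycle_indicU m (S T : pred 'I_m.+1) y :
    (forall i, S i -> ~~ T i) ->
  cls (act (indic (predU S T)) y) =
  cls (act (indic S) y) + cls (act (indic T) y).
Proof.
move=> ST; have := cls_b (act (collapse2 S T) y).
rewrite hoch_b_collapse2// !linearD linearN => /eqP.
by rewrite addrAC subr_eq0 addrC => /eqP.
Qed.

(** With S and T both empty, additivity says c = c + c. *)
Lemma cocycle_indic0 m (y : F m) : cls (act (indic pred0) y) = 0.
Proof.
have := @cocycle_indicU m pred0 pred0 y (fun i _ => isT).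
rewrite (@eq_indic _ (predU pred0 pred0) pred0)// => /eqP.
by rewrite -[X in X == _]addr0 (inj_eq (addrI _)) eq_sym => /eqP.
Qed.

Lemma cocycle_indic m (S : pred 'I_m.+1) y :
  cls (act (indic S) y) =
  \sum_(i | S i) cls (act (indic (pred1 i)) y).
Proof.
rewrite -big_filter; set r := filter _ _.
have -> : indic S = indic (mem r).
  by apply: eq_indic => i; rewrite /r /= mem_filter mem_index_enum andbT.
have : uniq r by rewrite filter_uniq ?index_enum_uniq.
elim: r => [|i r IH] /=; first by rewrite big_nil cocycle_indic0.
case/andP=> ir ur; rewrite big_cons -IH// -cocycle_indicU.
  by congr (cls (act _ y)); apply: eq_indic => j; rewrite /= inE.
by move=> j /= /eqP ->.
Qed.

(** The constant map 1 factors through the one-point set, where [cls_B] cancels its class against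
    that of the empty set, which is zero. *)
Lemma cocycle_indicT m (y : F m) : cls (act (indic predT) y) = 0.
Proof.
pose z : F 0%N := act ([ffun=> ord0] : {ffun 'I_m.+1 -> 'I_1}) y.
have -> : act (indic predT) y = act (indic predT) z.
  by rewrite act_comp indic_comp.
by have := cls_B z; rewrite connes_B0 linearD cocycle_indic0 addr0.
Qed.

(** Dictated by expanding x into characteristic functions of points, the one of S pairing with y to
    [cls (act (indic S) y)]. *)
Definition weight m (y : F m) (x : pointed_fun k m.+1) : W :=
  \sum_i val x (lift ord0 i) *: cls (act (indic (pred1 i)) y).

Lemma weight_linear m (y : F m) : linear (weight y).
Proof.
move=> a u v; rewrite /weight scaler_sumr -big_split; apply: eq_bigr => i _ /=.
by rewrite !ffunE scalerDl scalerA.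
Qed.
HB.instance Definition _ m (y : F m) :=
  GRing.isLinear.Build k (pointed_fun k m.+1) W _ (weight y) (weight_linear y).

Lemma weight_linearr m (x : pointed_fun k m.+1) : linear (fun y : F m => weight y x).
Proof.
move=> a u v; rewrite /weight scaler_sumr -big_split; apply: eq_bigr => i _ /=.
by rewrite !linearP.
Qed.

Lemma weight_const m (y : F m) : weight y (one_off_base k m) = 0.
Proof.
rewrite /weight -[RHS](cocycle_indicT y) cocycle_indic; apply: eq_bigr => i _.
by rewrite /= ffunE eq_sym neq_lift scale1r.
Qed.

(** The class of the fibre of f over j splits into the classes of its points, and each i lies in the
    fibre over [f i] alone. *)
Lemma weight_balanced m n (f : {ffun 'I_m.+1 -> 'I_n.+1}) x (y : F m) :
  weight y (t_map k (nu_map f) x) = weight (act f y) x.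
Proof.
rewrite /weight.
under [RHS]eq_bigr => j _.
  rewrite act_comp indic_comp cocycle_indic scaler_sumr; over.
rewrite (exchange_big_dep predT)//=; apply: eq_bigr => i _.
rewrite (big_pred1 (f i)) => [|j]; last by rewrite eq_sym.
by rewrite !ffunE liftK.
Qed.

Lemma weight_rel m (y : F m) (v : nu_t k m) :
  cokerfun_rel (F0_to_nu_t k) v -> weight y v = 0.
Proof.
move=> [u <-]; rewrite -[LHS]/((weight y \o F0_to_nu_t_comp k m) u).
rewrite -[RHS]/((\0 : {linear _ -> W}) u); apply: flift_ext => h.
by rewrite -[LHS]/(weight y (F0_to_nu_t_comp k m _)) flift_gen weight_const.
Qed.

Lemma tbar_tensor_univ :
  exists g : {linear tensor (tbar k) F -> W},
    forall m (x : pointed_fun k m.+1) (y : F m),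
      g (@tens k Fcat (tbar k) F m (qpi _ x) y) = weight y x.
Proof.
pose beta (m : Fcat) (x : tbar k m) (y : F m) : W := qlift (@weight_rel m y) x.
have betaE m x y : @beta m (qpi _ x) y = weight y x by exact: qliftE.
have [|m x a u v|m n f x y|g gE] := @tensor_univ k Fcat (tbar k) F W beta.
- by move=> m y; exact: linearP.
- by have [{}x <-] := qpi_surj x; rewrite !betaE; exact: weight_linearr.
- have [{}x <-] := qpi_surj x.
  by rewrite [fmap _ _ _]cokerfun_mapE !betaE; exact: weight_balanced.
by exists g => m x y; rewrite gE betaE.
Qed.
End CyclicCocycle.

(** * Classes in HC_1 *)

Lemma dout1_tot (u : F 1%N) :
  dout (fun i => @tot_d k F i : {linear tot F i.+1 -> tot F i}) 1
    ((idfun : {linear F 1%N -> tot F 1}) u) = 0.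
Proof. exact: hoch_b0. Qed.

(** Defined on all of [F 1]: since b vanishes there, every element is a cycle of the total
    complex. *)
Definition HC1_class : {linear F 1%N -> HC F 1} := qpi _ \o kercor dout1_tot.

Lemma HC1_class_b u : HC1_class (hoch_b u) = 0.
Proof.
apply/qpi_eq0/span_gen; exists (u, 0).
by rewrite /= linear0 addr0.
Qed.

Lemma HC1_class_B u : HC1_class (connes_B u) = 0.
Proof.
apply/qpi_eq0/span_gen; exists (0, u).
by rewrite /= linear0 add0r.
Qed.

(** * Characteristic functions in nu^* t *)

Lemma charfun_subproof m (S : pred 'I_m.+1) :
  ([ffun j => if unlift ord0 j is Some i then (S i)%:R else 0]
    : {ffun 'I_m.+2 -> k^o}) \in @based k m.+1.
Proof. by rewrite unfold_in ffunE unlift_none. Qed.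
Definition charfun m (S : pred 'I_m.+1) : pointed_fun k m.+1 :=
  exist (fun f => f \in @based k m.+1) _ (charfun_subproof S).

Lemma charfun_expand m (x : pointed_fun k m.+1) :
  x = \sum_i (val x (lift ord0 i) : k) *: charfun (pred1 i).
Proof.
apply: val_inj; apply/ffunP => j; rewrite linear_sum sum_ffunE /=.
case: (unliftP ord0 j) => [i ->|->].
  rewrite (bigD1 i)//= !ffunE liftK /= eqxx big1 ?addr0 ?[RHS]mulr1// => l li.
  by rewrite !ffunE liftK /= eq_sym (negPf li) scaler0.
rewrite (eqP (valP x)) big1// => i _.
by rewrite !ffunE unlift_none scaler0.
Qed.

(** Together with [charfun_expand] this shows that the characteristic function of 1 in {0, 1}
    generates nu^* t. *)
Lemma charfun_pullback m (S : pred 'I_m.+1) :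
  t_map k (nu_map (indic S)) (charfun (pred1 ord_max)) = charfun S.
Proof.
apply: val_inj; apply/ffunP => j; rewrite !ffunE.
case: (unliftP ord0 j) => [l _|_]; rewrite ?unlift_none// liftK ffunE.
by case: (S l).
Qed.

Lemma charfunU m (S T : pred 'I_m.+1) : (forall i, S i -> ~~ T i) ->
  charfun (predU S T) = charfun S + charfun T.
Proof.
move=> ST; apply: val_inj; apply/ffunP => j; rewrite !ffunE.
case: (unliftP ord0 j) => [l _|_]; rewrite ?addr0//=.
by case: (S l) (ST l) => [/(_ isT)/negPf ->|_]; rewrite ?addr0 ?add0r.
Qed.

Lemma charfun0 m : charfun (@pred0 'I_m.+1) = 0.
Proof. by apply: val_inj; apply/ffunP => j; rewrite !ffunE; case: (unliftP ord0 j). Qed.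

Lemma charfunT m : charfun (@predT 'I_m.+1) = one_off_base k m.
Proof.
apply: val_inj; apply/ffunP => j; rewrite !ffunE.
by case: (unliftP ord0 j) => [l ->|->]; rewrite ?eqxx// eq_sym neq_lift.
Qed.

Lemma indic_ord_max : indic (pred1 (@ord_max 1)) = fin_id 1.
Proof.
by apply/ffunP => i; rewrite !ffunE; case: i => [[|[]]]//= ?; apply: val_inj.
Qed.

Lemma collapse2_id : collapse2 (pred1 (inord 1)) (pred1 (@ord_max 2)) = fin_id 2.
Proof.
apply/ffunP => i; rewrite !ffunE /=.
by case: eqP => // i1; case: eqP => // i2; apply: val_inj;
  case: i i1 i2 => [[|[|[]]]]//= ? i1 i2; [case: i1|case: i2];
  apply: val_inj; rewrite /= ?inordK.
Qed.

(** Only the point 1 contributes, and its indicator on {0, 1} is the identity. *)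
Lemma weight_charfun (W : lmodType k) (cls : {linear F 1%N -> W}) (y : F 1%N) :
  weight cls y (charfun (pred1 ord_max)) = cls y.
Proof.
rewrite /weight (bigD1 ord_max)//= big1 ?addr0 => [|i ne].
  by rewrite ffunE liftK /= ?eqxx scale1r indic_ord_max [act _ _]fmap1.
by rewrite ffunE liftK /= (negPf ne) scale0r.
Qed.

(** * Balanced pairings restrict to maps out of [F 1] killed by b and B *)

Section Pairing.
Variables (W : lmodType k) (tns : forall m, pointed_fun k m.+1 -> F m -> W).
Arguments tns {m} _ _.
Hypothesis tns_linl : forall m (y : F m), linear (fun x : pointed_fun k m.+1 => tns x y).
Hypothesis tns_linr : forall m (x : pointed_fun k m.+1), linear (fun y : F m => tns x y).
Hypothesis tns_act : forall m n (f : {ffun 'I_m.+1 -> 'I_n.+1}) x (y : F m),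
  tns x (act f y) = tns (t_map k (nu_map f) x) y.
Hypothesis tns_one : forall m (y : F m), tns (one_off_base k m) y = 0.

Let tnsL m (y : F m) : {linear pointed_fun k m.+1 -> W} :=
  HB.pack (fun x : pointed_fun k m.+1 => tns x y)
    (GRing.isLinear.Build _ _ _ _ _ (tns_linl y)).
Let tnsR m (x : pointed_fun k m.+1) : {linear F m -> W} :=
  HB.pack (fun y : F m => tns x y) (GRing.isLinear.Build _ _ _ _ _ (tns_linr x)).

(** Pairing with the generator of nu^* t; it determines [tns] by [pair1_expand]. *)
Definition pair1 : {linear F 1%N -> W} := tnsR (charfun (pred1 (@ord_max 1))).

Lemma pair1_indic m (S : pred 'I_m.+1) (y : F m) :
  pair1 (act (indic S) y) = tns (charfun S) y.
Proof. by rewrite -[LHS]/(tns _ _) tns_act charfun_pullback. Qed.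

(** The identity of {0, 1, 2} is the map separating {1} and {2}, so b u measures the failure of
    additivity on these sets; characteristic functions of disjoint sets do add up. *)
Lemma pair1_b (u : F 2%N) : pair1 (hoch_b u) = 0.
Proof.
have -> : u = act (collapse2 (pred1 (inord 1)) (pred1 (@ord_max 2))) u.
  by rewrite collapse2_id [RHS]fmap1.
have ST (i : 'I_3) : pred1 (inord 1) i -> ~~ pred1 ord_max i.
  by move=> /eqP ->; rewrite /= -val_eqE /= inordK.
rewrite (hoch_b_collapse2 _ ST) linearD linearB !pair1_indic (charfunU ST).
rewrite -[tns (_ + _) u]/(tnsL u _) linearD.
by rewrite [X in _ - X]addrC opprD addNKr addNr.
Qed.

(** The summands of B pair u with the characteristic functions of everything, killed by [tns_one],
    and of the empty set, which is zero. *)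
Lemma pair1_B (u : F 0%N) : pair1 (connes_B u) = 0.
Proof.
rewrite connes_B0 linearD !pair1_indic charfun0 charfunT tns_one add0r.
exact: linear0 (tnsL u).
Qed.

Lemma pair1_expand m (x : pointed_fun k m.+1) (y : F m) :
  tns x y = \sum_i (val x (lift ord0 i) : k) *: pair1 (act (indic (pred1 i)) y).
Proof.
rewrite {1}(charfun_expand x) -[LHS]/(tnsL y _) linear_sum.
by apply: eq_bigr => i _; rewrite linearZ pair1_indic.
Qed.
End Pairing.

(** * The isomorphism between tbar (x) F and HC_1 *)

Definition tbar_tens m (x : pointed_fun k m.+1) (y : F m) : tensor (tbar k) F :=
  @tens k Fcat (tbar k) F m (qpi _ x) y.

Lemma tbar_tens_linl m (y : F m) : linear (fun x : pointed_fun k m.+1 => tbar_tens x y).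
Proof. by move=> a u v; rewrite /tbar_tens linearP; exact: tens_linearl. Qed.

Lemma tbar_tens_linr m (x : pointed_fun k m.+1) : linear (fun y : F m => tbar_tens x y).
Proof. by move=> a u v; exact: tens_linearr. Qed.

Lemma tbar_tens_act m n (f : {ffun 'I_m.+1 -> 'I_n.+1}) x (y : F m) :
  tbar_tens x (act f y) = tbar_tens (t_map k (nu_map f) x) y.
Proof. by rewrite /tbar_tens -tens_balanced [fmap _ _ _]cokerfun_mapE. Qed.

Lemma tbar_tens_one m (y : F m) : tbar_tens (one_off_base k m) y = 0.
Proof.
rewrite /tbar_tens (_ : qpi _ _ = 0); first exact: tens0l.
(* The map to the one-point set is a generator of [F0] with image [one_off_base]. *)
apply/qpi_eq0/span_gen; exists (fgen k [ffun=> ord0]).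
exact: flift_gen.
Qed.

Lemma tbar_tensor_iso : lmod_iso (tensor (tbar k) F) (HC F 1).
Proof.
have [g gE] := tbar_tensor_univ HC1_class_b HC1_class_B.
pose phi1 := pair1 tbar_tens_linr.
have phi0 (z : kermod (dout (fun i => @tot_d k F i : {linear tot F i.+1 -> tot F i}) 1)) :
    (exists u, @tot_d k F 1 u = val z) -> (phi1 \o kerval _) z = 0.
  move=> [[u v] uvz]; rewrite -[LHS]/(phi1 (val z)) -uvz.
  rewrite -[X in phi1 X]/(hoch_b u + connes_B v) linearD.
  rewrite (pair1_b tbar_tens_linl tbar_tens_linr tbar_tens_act) add0r.
  exact: (pair1_B tbar_tens_linl tbar_tens_linr tbar_tens_act tbar_tens_one).
pose phi : {linear HC F 1 -> tensor (tbar k) F} := qlift phi0.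
have phiE y : phi (HC1_class y) = phi1 y by exact: qliftE.
apply: (@lmod_iso_cancel _ _ _ g phi) => x.
  (* On pure tensors, phi after g expands x into points, and [pair1_expand] reassembles them. *)
  rewrite -[LHS]/((phi \o g) x) -[RHS]/((idfun : {linear _ -> _}) x).
  apply: tensor_ext => m {}x y; have [{}x <-] := qpi_surj x.
  rewrite -[LHS]/(phi (g _)) gE linear_sum.
  rewrite -[RHS]/(tbar_tens x y).
  rewrite (pair1_expand tbar_tens_linl tbar_tens_linr tbar_tens_act).
  by apply: eq_bigr => i _; rewrite linearZ phiE.
(* Every class comes from [F 1], where g after phi evaluates [weight] at the generator. *)
have [z <-] := qpi_surj x.
have -> : qpi _ z = HC1_class (val z).
  by rewrite /=; congr (qpi _ _); apply: val_inj.
by rewrite phiE gE weight_charfun.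
Qed.
End DegreeOne.

Theorem proposition5p4 (k : comPzRingType) :
  (forall F : modfunctor k Fcat, lmod_iso (HGammaC 0 F) (HC F 1)) /\
  (forall (A : comPzRingType) (eta : {rmorphism k -> A}),
     lmod_iso (HGammaC_alg eta 0) (HC_alg eta 1)).
Proof.
have iso (F : modfunctor k Fcat) : lmod_iso (HGammaC 0 F) (HC F 1).
  exact: lmod_iso_trans (TorR0_iso _ F) (tbar_tensor_iso F).
by split=> // A eta; exact: iso.
Qed.
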